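(* There exist an integer $n\ge 2$ and a digit set $\mathcal D\subset\{0,1,\ldots,n-1\}^3$ with $2\le\#\mathcal D<n^3$ such that, for the fractal cube $F\subset\mathbb R^3$ determined by $n$ and $\mathcal D$, the set $H^c=\mathbb R^3\setminus H$, where $H=F+\mathbb Z^3$, is connected, and $H$ is the union of uncountably many connected components, each of which is unbounded and invariant under all translations by vectors of $\mathbb Z^3$.
   Context: Given $n\ge 2$ and a digit set $\mathcal D\subset\{0,1,\ldots,n-1\}^k$ with $2\le\#\mathcal D<n^k$, the fractal $k$-cube determined by $(n,\mathcal D)$ is the unique non-empty compact set $F\subset\mathbb R^k$ with $F=\frac{F+\mathcal D}{n}=\bigcup_{d\in\mathcal D}\frac{F+d}{n}$. Here $H=F+\mathbb Z^3=\{x+v: x\in F, v\in\mathbb Z^3\}$ and $H^c=\mathbb R^3\setminus H$. *)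

(* Defs.v *)
From HB Require Import structures.
From mathcomp Require Import all_boot all_order all_algebra.
From mathcomp Require Import all_classical all_reals all_analysis.
From mathcomp Require Import Rstruct Rstruct_topology.
Set Implicit Arguments. Unset Strict Implicit. Unset Printing Implicit Defensive.
Import Order.TTheory GRing.Theory Num.Theory.
Local Open Scope classical_set_scope.
Local Open Scope ring_scope.

Notation R := Rdefinitions.R.
Notation vec3 := 'rV[R]_3.

Definition digit_vec (n : nat) (d : {ffun 'I_3 -> 'I_n}) : vec3 :=
  \row_i ((d i : nat)%:R).

Definition int_vec (z : 'I_3 -> int) : vec3 := \row_i ((z i)%:~R).

(* F is the (unique) non-empty compact set with F = \bigcup_{d in D} (F + d)/n *)
Definition is_fractal_cube (n : nat) (D : {set {ffun 'I_3 -> 'I_n}})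
    (F : set vec3) : Prop :=
  [/\ F !=set0, compact F &
      F = \bigcup_(d in [set d | d \in D])
            [set (n%:R)^-1 *: (x + digit_vec d) | x in F]].

Definition lattice_hull (F : set vec3) : set vec3 :=
  [set y | exists x, exists z : 'I_3 -> int, F x /\ y = x + int_vec z].

Definition components (A : set vec3) : set (set vec3) :=
  [set connected_component A x | x in A].

(* Main.v *)
Require Import Defs.
From HB Require Import structures.
From mathcomp Require Import all_boot all_order all_algebra.
From mathcomp Require Import all_classical all_reals all_analysis.
From mathcomp Require Import Rstruct Rstruct_topology.
From mathcomp Require Import lra zify.
Set Implicit Arguments. Unset Strict Implicit. Unset Printing Implicit Defensive.
Import Order.TTheory GRing.Theory Num.Theory.
Import numFieldNormedType.Exports.
Local Open Scope classical_set_scope.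
Local Open Scope ring_scope.

(* Take n = 5 and let the digits be the triples of which at least two entries
   equal 1, or at least two equal 3. Call a real number a b-point when it lies in
   [b/5, (b+1)/5] + Z, and let the b-cross be the set of points with at least two
   coordinates b-points (b = 1, 3). The two crosses are closed, disjoint and
   Z^3-periodic, and H is the set of all x such that every 5^k x lies in one of
   them. Hence H is the disjoint union, over a in {1,3}^N, of the strands
   S_a = {x : 5^k x lies in the a_k-cross for all k}, and a connected subset of H
   lies in a single strand. A strand is connected: with e = 0.a_0 a_1 ... in base
   5, it contains all lines on which two coordinates are congruent to e modulo 1,
   and rescaled copies of such lines, joined to them inside the unit cube,
   approximate each of its points. The complement of H is the union over k of the
   sets 5^-k V, where V, the complement of both crosses, is connected and
   contains 0. *)

(** * Connected components and motion along the coordinate axes *)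

Section Linked.
Variable T : topologicalType.
Implicit Types (A B : set T) (x y : T).

Lemma sub_connected_component A B x y :
  A `<=` B -> connected_component A x y -> connected_component B x y.
Proof.
by move=> AB [C [Cx CA cC] Cy]; exists C => //; split => //; exact: subset_trans AB.
Qed.

Lemma linked_connected A x :
  (forall y, A y -> connected_component A x y) -> connected A.
Proof.
move=> Ax; suff -> : A = connected_component A x by exact: component_connected.
by apply/seteqP; split => // y; exact: connected_component_sub.
Qed.

Lemma image_connected_component (U : topologicalType) (f : T -> U) A
    (B : set U) x y : continuous f -> f @` A `<=` B ->
  connected_component A x y -> connected_component B (f x) (f y).
Proof.
move=> cf fAB [C [Cx CA cC] Cy]; exists (f @` C); last by exists y.
split; first by exists x.
- by apply: subset_trans fAB; exact: image_subset.
- by apply: connected_continuous_connected => //; exact: continuous_subspaceT.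
Qed.

End Linked.

Definition upd (x : vec3) (i : 'I_3) (t : R) : vec3 :=
  x + (t - x 0 i) *: delta_mx 0 i.

Lemma updE x i t j : upd x i t 0 j = if j == i then t else x 0 j.
Proof.
rewrite !mxE eqxx /=; case: eqP => [->|_] /=; last by rewrite mulr0 addr0.
by rewrite mulr1 addrC subrK.
Qed.

Lemma upd_id x i : upd x i (x 0 i) = x.
Proof. by rewrite /upd subrr scale0r addr0. Qed.

Lemma continuous_upd x i : continuous (upd x i).
Proof.
move=> t; apply: cvgD; first exact: cvg_cst.
apply: cvgZr_tmp.
by apply: cvgD; [exact: cvg_id|exact: cvg_cst].
Qed.

Lemma upd_linked (A : set vec3) x i (s t : R) :
  (forall u, Num.min s t <= u <= Num.max s t -> A (upd x i u)) ->
  connected_component A (upd x i s) (upd x i t).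
Proof.
move=> sub; apply: (@image_connected_component _ _ (upd x i)
  `[Num.min s t, Num.max s t]%classic); first exact: continuous_upd.
  by move=> y [u]; rewrite /= in_itv /= => /sub h <-.
exists `[Num.min s t, Num.max s t]%classic; last first.
  by rewrite /= in_itv /= ge_min le_max lexx !orbT.
split => //; first by rewrite /= in_itv /= ge_min le_max lexx.
exact: segment_connected.
Qed.

Lemma ord3_all (P : 'I_3 -> Prop) : P 0 -> P 1 -> P 2%R -> forall i, P i.
Proof.
move=> P0 P1 P2 [[|[|[|//]]] lti]; [move: P0|move: P1|move: P2];
  by congr P; exact: val_inj.
Qed.

(** The coordinates are replaced one at a time; meanwhile the other two stay in [P], so each segment
    remains in [A]. It serves both for the complement of the crosses and for the strands. *)
Lemma axes_linked (P : set R) (A : set vec3) (x y : vec3) :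
  (forall z : vec3, (exists i, forall j, j != i -> P (z 0 j)) -> A z) ->
  (forall i, P (x 0 i)) -> (forall i, P (y 0 i)) -> connected_component A x y.
Proof.
move=> PA Px Py.
have step (z : vec3) i : (forall j, P (z 0 j)) ->
    connected_component A z (upd z i (y 0 i)).
  move=> Pz; rewrite -{1}(upd_id z i); apply: upd_linked => u _.
  by apply: PA; exists i => j ji; rewrite updE (negbTE ji).
have Pupd (z : vec3) i : (forall j, P (z 0 j)) -> forall j, P (upd z i (y 0 i) 0 j).
  by move=> Pz j; rewrite updE; case: (j =P i) => _; [exact: Py|exact: Pz].
have := step x 0 Px; have := step _ 1 (Pupd x 0 Px).
have := step _ 2 (Pupd _ 1 (Pupd x 0 Px)).
set z := upd (upd (upd _ _ _) _ _) _ _; have -> : z = y.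
  by apply/rowP; apply: ord3_all; rewrite /z !updE.
move=> h2 h1 h0; apply: connected_component_trans h2.
exact: connected_component_trans h1.
Qed.

(** * Bands on the line and crosses in space *)

Lemma ltr_int_eq (m m' : int) :
  (m%:~R : R) < m'%:~R + 1 -> (m'%:~R : R) < m%:~R + 1 -> m = m'.
Proof. by rewrite -!intrD1 !ltr_int; lia. Qed.

Definition dig (b : bool) : nat := if b then 3 else 1.

Definition band (b : bool) : set R :=
  [set t | exists m : int, (dig b)%:R <= 5 * (t - m%:~R) <= (dig b)%:R + 1].

Lemma dig_range b : 1 <= ((dig b)%:R : R) <= 3.
Proof. by case: b => /=; lra. Qed.

Lemma bandDz b t (m : int) : band b (t + m%:~R) <-> band b t.
Proof.
split=> -[k hk]; [exists (k - m)|exists (k + m)].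
  by rewrite rmorphB /=; move: hk; lra.
by rewrite rmorphD /=; move: hk; lra.
Qed.

(* The bands lie in the interior of the unit interval, so no integer translate
   other than that by [m] needs to be considered when m <= t <= m + 1. *)
Lemma band_itv b t (m : int) : m%:~R <= t <= m%:~R + 1 ->
  band b t -> (dig b)%:R <= 5 * (t - m%:~R) <= (dig b)%:R + 1.
Proof.
move=> mt [k hk]; have := dig_range b => db.
by rewrite (@ltr_int_eq m k) //; lra.
Qed.

Lemma bandP b t : band b t <->
  (dig b)%:R <= 5 * (t - (Num.floor t)%:~R) <= (dig b)%:R + 1.
Proof.
split=> [|h]; last by exists (Num.floor t).
apply: band_itv; have := floor_itv t; rewrite intrD1; lra.
Qed.

Lemma band_disjoint b b' t : band b t -> band b' t -> b = b'.
Proof. by rewrite !bandP; case: b b' => -[] //=; lra. Qed.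

Lemma closed_band b : closed (band b).
Proof.
rewrite -openC.
suff -> : ~` band b = \bigcup_(m in @setT int)
    `](((dig b)%:R + 1) / 5 + m%:~R - 1 : R), ((dig b)%:R / 5 + m%:~R)[%classic.
  by apply: bigcup_open => m _; exact: interval_open.
apply/seteqP; split=> [t nbt|t [m _] /=].
  (* Translate [m] of the band is the last one starting at or below [t]; as [t] is outside it, [t]
     lies in the gap before translate [m + 1]. *)
  pose m := Num.floor (t - (dig b)%:R / 5).
  exists (m + 1) => //=; rewrite in_itv /= intrD1.
  have := floor_itv (t - (dig b)%:R / 5); rewrite -/m intrD1 => hm.
  have [le|gt] := leP (5 * (t - m%:~R)) ((dig b)%:R + 1); last lra.
  by exfalso; apply: nbt; exists m; lra.
rewrite in_itv /= => h [k hk].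
have km : k = m by apply: ltr_int_eq; lra.
by move: h hk; rewrite km; lra.
Qed.

Definition cross (b : bool) : set vec3 :=
  [set x | exists i, forall j, j != i -> band b (x 0 j)].

Lemma sub_cross b (x y : vec3) :
  (forall j, band b (x 0 j) -> band b (y 0 j)) -> cross b x -> cross b y.
Proof. by move=> xy [i xi]; exists i => j /xi /xy. Qed.

Lemma third_coordinate (i i' : 'I_3) : exists j, (j != i) && (j != i').
Proof.
apply/existsP; move: i i'; apply: ord3_all; apply: ord3_all;
  by apply/existsP; (exists 0; done) || (exists 1; done) || (exists 2; done).
Qed.

(** Each cross leaves only one coordinate free, so one of the three is constrained by both. *)
Lemma cross_disjoint b b' x : cross b x -> cross b' x -> b = b'.
Proof.
move=> [i xi] [i' xi']; have [j /andP[ji ji']] := third_coordinate i i'.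
by apply: band_disjoint (xi j ji) (xi' j ji').
Qed.

Lemma closed_cross b : closed (cross b).
Proof.
have -> : cross b = \bigcup_(i in @setT 'I_3) \bigcap_(j in [set j | j != i])
    ((fun x : vec3 => x 0 j) @^-1` band b).
  apply/seteqP; split => x; first by case=> i xi; exists i => // j /xi.
  by case=> i _ xi; exists i => j /xi.
apply: closed_bigcup => [|i _]; [exact: finite_finset|apply: closed_bigI] => j _.
apply: preimage_closed; last exact: closed_band.
by move=> x _; exact: coord_continuous.
Qed.

Lemma crossDz b (x : vec3) z : cross b (x + int_vec z) <-> cross b x.
Proof. by split; apply: sub_cross => j; rewrite !mxE bandDz. Qed.

(** * The region outside both crosses *)

Definition open_cross : set vec3 := [set x | forall b, ~ cross b x].

Lemma gap_exit (u : R) : exists s, (forall b, ~ band b s) /\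
  forall t b, Num.min u s <= t <= Num.max u s -> band b t -> band b u.
Proof.
have [[b0 [m hm]]|nb] := pselect (exists b, band b u); last first.
  exists u; split => [b ?|t b]; first by apply: nb; exists b.
  by rewrite minxx maxxx => tu; have -> : t = u by apply/eqP; rewrite eq_le andbC.
have d0 := dig_range b0.
(* This is the middle of the next fifth, that of digit 2 or 4, so the way up from [u] meets no band
   other than that of [b0]. *)
exists (m%:~R + ((dig b0)%:R + 3 / 2) / 5); split => [b /(@band_itv _ _ m)|t b].
  by case: b b0 {d0 hm} => -[] /=; lra.
rewrite min_l ?max_r; [|lra..] => ht /(@band_itv _ _ m) hb.
suff -> : b = b0 by exists m.
by case: b hb; case: b0 hm d0 ht => //=; lra.
Qed.

Lemma open_cross0 : open_cross 0.
Proof.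
move=> b [i /(_ (i + 1))]; rewrite mxE => h.
have /h/(@band_itv _ _ 0) : i + 1 != i.
  by rewrite -subr_eq0 addrC addKr.
by have := dig_range b; lra.
Qed.

(* A point whose coordinates all avoid both bands can be moved to any other such
   point by changing one coordinate at a time, and every point reaches such a
   point by pushing its coordinates upwards out of their bands. *)
Lemma open_cross_connected : connected open_cross.
Proof.
pose P : set R := [set t | forall b, ~ band b t].
have P0 (i : 'I_3) : P ((0 : vec3) 0 i).
  move=> b /(@band_itv _ _ 0); rewrite mxE.
  by have := dig_range b; lra.
have PV (z : vec3) : (exists i, forall j, j != i -> P (z 0 j)) -> open_cross z.
  move=> [i zi] b [i' zi']; have [j /andP[ji ji']] := third_coordinate i i'.
  exact: zi (zi' j ji').
have step (x : vec3) i : open_cross x -> exists2 s, P s &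
    connected_component open_cross x (upd x i s).
  move=> Vx; have [s [Ps hs]] := gap_exit (x 0 i); exists s => //.
  rewrite -{1}(upd_id x i); apply: upd_linked => t ht b xb; apply: (Vx b).
  apply: sub_cross xb => j; rewrite updE; case: eqP => // ->; exact: hs.
apply: (@linked_connected _ open_cross (0 : vec3)) => x Vx.
apply: connected_component_sym.
have [s0 Ps0 x0] := step x 0 Vx.
have [s1 Ps1 x1] := step _ 1 (connected_component_sub x0).
have [s2 Ps2 x2] := step _ 2 (connected_component_sub x1).
apply: connected_component_trans x0 _; apply: connected_component_trans x1 _.
apply: connected_component_trans x2 _; apply: axes_linked PV _ P0.
by apply: ord3_all; rewrite !updE.
Qed.

(** * Strands and their self-similarity *)

Definition seq_tail (a : nat -> bool) : nat -> bool := fun k => a k.+1.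

Definition strand (a : nat -> bool) : set vec3 :=
  [set x | forall k, cross (a k) (5 ^+ k *: x)].

Definition cube : set vec3 := [set x | forall i, 0 <= x 0 i <= 1].

Lemma scale_int_vec k z :
  (5 ^+ k : R) *: int_vec z = int_vec (fun i => 5 ^+ k * z i).
Proof. by apply/rowP => j; rewrite !mxE rmorphM rmorphXn. Qed.

Lemma strandDz a (x : vec3) z : strand a (x + int_vec z) <-> strand a x.
Proof.
by split => ax k; have := ax k; rewrite scalerDr scale_int_vec crossDz.
Qed.

Lemma strand_cons a x :
  strand a x <-> cross (a 0%N) x /\ strand (seq_tail a) (5 *: x).
Proof.
split=> [ax|[x0 ax] [|k]]; last 2 first.
- by rewrite expr0 scale1r.
- by rewrite exprSr -scalerA; exact: ax.
split=> [|k]; first by have := ax 0%N; rewrite expr0 scale1r.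
by have := ax k.+1; rewrite exprSr -scalerA.
Qed.

Lemma strand_inj a b x : strand a x -> strand b x -> a = b.
Proof. by move=> ax bx; apply/funext => k; exact: cross_disjoint (ax k) (bx k). Qed.

(** These digits index the cells of the unit cube that lie in the [b]-cross. *)
Definition arm (b : bool) (d : {ffun 'I_3 -> 'I_5}) : bool :=
  [exists i, forall j, (j != i) ==> (d j == dig b :> nat)].

Lemma armP b (d : {ffun 'I_3 -> 'I_5}) :
  reflect (exists i, forall j, j != i -> d j = dig b :> nat) (arm b d).
Proof.
apply: (iffP existsP) => -[i di]; exists i.
  by move=> j ji; apply/eqP; move/forallP: di => /(_ j); rewrite ji.
by apply/forallP => j; apply/implyP => /di ->.
Qed.

Lemma quintic_digit (t : R) : 0 <= t <= 1 ->
  exists k : 'I_5, (k : nat)%:R <= 5 * t <= (k : nat)%:R + 1.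
Proof.
move=> t01.
have [?|?] := leP (5 * t) 1; first by exists (@Ordinal 5 0 isT) => /=; lra.
have [?|?] := leP (5 * t) 2; first by exists (@Ordinal 5 1 isT) => /=; lra.
have [?|?] := leP (5 * t) 3; first by exists (@Ordinal 5 2 isT) => /=; lra.
have [?|?] := leP (5 * t) 4; first by exists (@Ordinal 5 3 isT) => /=; lra.
by exists (@Ordinal 5 4 isT) => /=; lra.
Qed.

Lemma cell_cross b d x : arm b d -> cube x ->
  cross b (5^-1 *: (x + digit_vec d)).
Proof.
move=> /armP[i di] Qx; exists i => j /di dj.
by exists 0; rewrite !mxE dj; have := Qx j; lra.
Qed.

Lemma cell_cube d x : cube x -> cube (5^-1 *: (x + @digit_vec 5 d)).
Proof.
move=> Qx i; rewrite !mxE; have := Qx i.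
have : ((d i : nat)%:R : R) <= 4 by rewrite (ler_nat _ _ 4) -ltnS.
by have : 0 <= ((d i : nat)%:R : R) by []; lra.
Qed.

(** Off the axis [i] the band forces the digit; along it, any fifth containing the coordinate will
    do. *)
Lemma cross_cell b x : cube x -> cross b x ->
  exists2 d, arm b d & cube (5 *: x - digit_vec d).
Proof.
move=> Qx [i xi]; have [k hk] := quintic_digit (Qx i).
have dig5 : (dig b < 5)%N by case: b {xi}.
exists [ffun j => if j == i then k else Ordinal dig5].
  by apply/armP; exists i => j ji; rewrite ffunE (negbTE ji).
move=> j; rewrite !mxE ffunE; case: (j =P i) => [->|/eqP ji]; first lra.
have : (0%:~R : R) <= x 0 j <= 0%:~R + 1 by have := Qx j; lra.
by move/band_itv => /(_ _ (xi j ji)) /=; lra.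
Qed.

Lemma digit_vec_int n (d : {ffun 'I_3 -> 'I_n}) :
  digit_vec d = int_vec (fun i => (d i : nat)%:Z).
Proof. by apply/rowP => j; rewrite !mxE. Qed.

Lemma strandDd a (x : vec3) (d : {ffun 'I_3 -> 'I_5}) :
  strand a (x + digit_vec d) <-> strand a x.
Proof. by rewrite digit_vec_int strandDz. Qed.

Definition cube_strand a := strand a `&` cube.

Lemma cube_strand_cell a d x : arm (a 0%N) d -> cube_strand (seq_tail a) x ->
  cube_strand a (5^-1 *: (x + digit_vec d)).
Proof.
move=> ad [ax Qx]; split; last exact: cell_cube.
apply/strand_cons; split; first exact: cell_cross.
by rewrite scalerA divff ?scale1r ?pnatr_eq0// strandDd.
Qed.

(** Together with [cube_strand_cell] this is the self-similarity equation. Refining by one level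
    shifts the sequence, which is why later inductions on the level generalise over [a]. *)
Lemma cube_strandP a x : cube_strand a x -> exists2 d, arm (a 0%N) d &
  exists2 y, cube_strand (seq_tail a) y & x = 5^-1 *: (y + digit_vec d).
Proof.
move=> [/strand_cons[x0 ax] Qx]; have [d ad Qd] := cross_cell Qx x0.
exists d => //; exists (5 *: x - digit_vec d).
  by split=> //; rewrite -(strandDd _ _ d) subrK.
by rewrite subrK scalerA mulVf ?scale1r ?pnatr_eq0.
Qed.

(** * The number with base-5 digits [dig (a k)] *)

Fixpoint expansion_sum (a : nat -> bool) (m : nat) : R :=
  if m is m'.+1 then ((dig (a 0%N))%:R + expansion_sum (seq_tail a) m') / 5 else 0.

Lemma expansion_sum_itv a m : 0 <= expansion_sum a m <= 1.
Proof.
elim: m a => [|m IH] a /=; first lra.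
by have := IH (seq_tail a); have := dig_range (a 0%N); lra.
Qed.

Lemma cvg_expansion_sum a : cvgn (expansion_sum a).
Proof.
apply: nondecreasing_is_cvgn.
  apply/nondecreasing_seqP => m; elim: m a => [|m IH] a.
    by have := expansion_sum_itv a 1; rewrite /=; lra.
  by have := IH (seq_tail a) => /=; lra.
by exists 1 => _ [m _ <-]; have := expansion_sum_itv a m; lra.
Qed.

Definition expansion a : R := limn (expansion_sum a).

(** The partial sums recurse on the leading digit, so their defining equation passes to the
    limit. *)
Lemma expansionE a :
  expansion a = ((dig (a 0%N))%:R + expansion (seq_tail a)) / 5.
Proof.
apply: cvg_lim; first exact: Rhausdorff.
rewrite -cvg_shiftS /=.
apply: cvgMr_tmp; apply: cvgD; first exact: cvg_cst.
exact: cvg_expansion_sum.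
Qed.

Lemma expansion_itv a : 0 <= expansion a <= 1.
Proof.
apply/andP; split.
  apply: limr_ge; first exact: cvg_expansion_sum.
  by apply: nearW => m; have := expansion_sum_itv a m; lra.
apply: limr_le; first exact: cvg_expansion_sum.
by apply: nearW => m; have := expansion_sum_itv a m; lra.
Qed.

(** Multiplying by 5 moves the leading digit into the integer part, which [band] ignores, and leaves
    the expansion of the shifted sequence. *)
Lemma band_expansion a k : band (a k) (5 ^+ k * expansion a).
Proof.
elim: k a => [|k IH] a.
  exists 0; rewrite expr0 expansionE.
  by have := expansion_itv (seq_tail a); lra.
rewrite exprSr -mulrA expansionE [5 * _]mulrC divfK ?pnatr_eq0// mulrDr addrC.
have -> : 5 ^+ k * (dig (a 0%N))%:R = ((5 ^+ k * (dig (a 0%N))%:Z)%:~R : R).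
  by rewrite rmorphM rmorphXn.
by rewrite bandDz; exact: IH.
Qed.

(** * Connectedness of a strand *)

Lemma strand_line a (x : vec3) : (exists i, forall j, j != i ->
  exists m : int, x 0 j = expansion a + m%:~R) -> strand a x.
Proof.
move=> [i xi] k; exists i => j /xi [m xj]; rewrite mxE xj mulrDr.
have -> : 5 ^+ k * m%:~R = ((5 ^+ k * m)%:~R : R) by rewrite rmorphM rmorphXn.
by rewrite bandDz; exact: band_expansion.
Qed.

Definition centre a : vec3 := const_mx (expansion a).

Lemma cube_strand_centre a : cube_strand a (centre a).
Proof.
split; last by move=> i; rewrite mxE expansion_itv.
by apply: strand_line; exists 0 => j _; exists 0; rewrite mxE addr0.
Qed.

(** By [expansionE], the image of the next centre agrees with [centre a] in the two coordinates
    where [d] is [dig (a 0)]. The segment between them thus lies on a line of the strand, and it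
    stays in the cube by convexity. *)
Lemma centre_cell_linked a d : arm (a 0%N) d ->
  connected_component (cube_strand a) (centre a)
    (5^-1 *: (centre (seq_tail a) + digit_vec d)).
Proof.
move=> ad; have /armP[i di] := ad.
set y := _ *: _; have Qy : cube y.
  by apply: cell_cube; case: (cube_strand_centre (seq_tail a)).
have -> : y = upd (centre a) i (y 0 i).
  apply/rowP => j; rewrite updE; case: (j =P i) => [->//|/eqP /di dj].
  by rewrite !mxE dj [RHS]expansionE; lra.
have := expansion_itv a; have := Qy i; move: (y 0 i) => t t01 e01.
rewrite -{1}(upd_id (centre a) i); apply: upd_linked => u.
rewrite mxE => tu; split.
  apply: strand_line; exists i => j ji; exists 0.
  by rewrite updE (negbTE ji) mxE addr0.
move=> j; rewrite updE mxE; case: (j =P i) => _; last lra.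
by move: tu; case: (leP (expansion a) t) => _; lra.
Qed.

Lemma continuous_scaleD (k : R) (y : vec3) :
  continuous (fun x : vec3 => k *: (x + y)).
Proof.
move=> z; apply: (@cvgZ _ _ _ (nbhs z)); first exact: cvg_cst.
by apply: cvgD; [exact: cvg_id|exact: cvg_cst].
Qed.

Lemma continuous_scale (k : R) : continuous (fun x : vec3 => k *: x).
Proof.
by move=> z; apply: (@cvgZ _ _ _ (nbhs z)); [exact: cvg_cst|exact: cvg_id].
Qed.

Lemma vec_norm_le (x : vec3) (e : R) :
  0 <= e -> (forall i, `|x 0 i| <= e) -> `|x| <= e.
Proof.
move=> e0 xe; rewrite /Num.norm /= mx_normrE; apply: bigmax_le => // -[i j] _ /=.
by rewrite ord1.
Qed.

Lemma coord_norm_le (x : vec3) i : `|x 0 i| <= `|x|.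
Proof.
rewrite [leRHS]/Num.norm /= mx_normrE.
by apply/bigmax_geP; right; exists (0, i).
Qed.

Lemma cube_norm_sub (x y : vec3) : cube x -> cube y -> `|x - y| <= 1.
Proof.
move=> Qx Qy; apply: vec_norm_le => // i; rewrite !mxE ler_norml.
by have := Qx i; have := Qy i; lra.
Qed.

(** A link found for the shifted sequence is copied into the cell at a fifth of its size; its
    starting point is already linked to [centre a]. *)
Lemma cube_strand_approx k a x : cube_strand a x -> exists2 y,
  connected_component (cube_strand a) (centre a) y & `|x - y| <= 5 ^- k.
Proof.
elim: k a x => [|k IH] a x ax.
  exists (centre a); first exact/connected_component_refl/cube_strand_centre.
  by rewrite expr0 invr1; apply: cube_norm_sub; [case: ax|case: (cube_strand_centre a)].
have [d ad [x' ax' ->]] := cube_strandP ax.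
have [y' ay' xy'] := IH _ _ ax'.
exists (5^-1 *: (y' + digit_vec d)).
  apply: connected_component_trans (centre_cell_linked ad) _.
  pose f (y : vec3) : vec3 := 5^-1 *: (y + digit_vec d).
  have fsub : f @` cube_strand (seq_tail a) `<=` cube_strand a.
    by move=> y [u /(cube_strand_cell ad) h <-].
  exact: image_connected_component (@continuous_scaleD _ _) fsub ay'.
rewrite -scalerBr opprD addrACA subrr addr0 normrZ exprS invfM.
by rewrite ger0_norm // ler_pM2l.
Qed.

Lemma closed_scaled_cross b k : closed ((fun x : vec3 => 5 ^+ k *: x) @^-1` cross b).
Proof.
apply: preimage_closed; last exact: closed_cross.
by move=> x _; exact: continuous_scale.
Qed.

Lemma closed_strand a : closed (strand a).
Proof.
have -> : strand a = \bigcap_k ((fun x : vec3 => 5 ^+ k *: x) @^-1` cross (a k)).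
  by apply/seteqP; split => x ax k; [move=> _; exact: ax|exact: ax].
by apply: closed_bigI => k _; exact: closed_scaled_cross.
Qed.

Lemma vec_split (x : vec3) : exists z, cube (x - int_vec z).
Proof.
exists (fun i => Num.floor (x 0 i)) => i; rewrite !mxE.
by have := floor_itv (x 0 i); rewrite intrD1; lra.
Qed.

Lemma closed_approx (A : set vec3) x : closed A ->
  (forall k, exists2 y, A y & `|x - y| <= 5 ^- k) -> A x.
Proof.
move=> cA xA; rewrite -[A]setCK => nAx.
have /nbhs_ballP[e /= e0 eA] : nbhs x (~` A).
  by apply: open_nbhs_nbhs; split => //; exact: closed_openC.
near \oo => k; have [y Ay xy] := xA k; apply: (eA y) => //.
rewrite -ball_normE /=; apply: le_lt_trans xy _.
(* Since 5^-k is at most 2^-k, it suffices that 2^-k falls below the radius. *)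
have : 1 / 2 ^+ k < (PosNum e0)%:num.
  by near: k; exact: near_infty_natSinv_expn_lt.
apply: le_lt_trans; rewrite div1r lef_pV2 ?posrE ?exprn_gt0//.
by rewrite lerXn2r ?nnegrE// ler_nat.
Unshelve. all: by end_near. Qed.

Lemma strand_connected a : connected (strand a).
Proof.
apply: (@linked_connected _ _ (centre a)) => x ax.
have [z Qz] := vec_split x; set y := x - int_vec z in Qz.
have ay : cube_strand a y by split => //; rewrite -(strandDz _ _ z) subrK.
have cy : connected_component (strand a) (centre a) y.
  (* Components of a closed set are closed, so it suffices to find linked points arbitrarily close
     to [y]. *)
  apply: closed_approx => [|k]; first exact/component_closed/closed_strand.
  have [u cu yu] := cube_strand_approx k ay; exists u => //.
  by apply: sub_connected_component cu => v [].
pose P : set R := [set t | exists m : int, t = expansion a + m%:~R].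
(* The centre is first moved by [z] along lines of the strand; the link from [centre a] to [y],
   translated by [z], then ends at [x]. *)
apply: (@connected_component_trans _ _ (centre a + int_vec z)).
  apply: (@axes_linked P); first exact: strand_line.
    by move=> i; exists 0; rewrite mxE addr0.
  by move=> i; exists (z i); rewrite !mxE.
have zsub : (fun u : vec3 => 1 *: (u + int_vec z)) @` strand a `<=` strand a.
  by move=> _ [u au <-]; rewrite scale1r strandDz.
have := image_connected_component (@continuous_scaleD 1 _) zsub cy.
by rewrite !scale1r subrK.
Qed.

(** * The union of all strands, its complement and its components *)

Definition web : set vec3 := [set x | forall k, exists b, cross b (5 ^+ k *: x)].

Lemma webP x : web x <-> exists a, strand a x.
Proof.
split=> [wx|[a ax] k]; last by exists (a k); exact: ax.
by have [a ax] := choice wx; exists a.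
Qed.

Lemma webDz (x : vec3) z : web (x + int_vec z) <-> web x.
Proof.
by split => /webP[a ax]; apply/webP; exists a; move: ax; rewrite strandDz.
Qed.

Lemma closed_web : closed web.
Proof.
have -> : web = \bigcap_k \bigcup_(b in @setT bool)
    ((fun x : vec3 => 5 ^+ k *: x) @^-1` cross b).
  apply/seteqP; split => x wx k.
    by move=> _; have [b] := wx k; exists b.
  by have [//|b _] := wx k; exists b.
apply: closed_bigI => k _; apply: closed_bigcup; first exact: finite_finset.
by move=> b _; exact: closed_scaled_cross.
Qed.

Lemma web_compl_connected : connected (~` web).
Proof.
have -> : ~` web = \bigcup_k ((fun x : vec3 => 5 ^- k *: x) @` open_cross).
  apply/seteqP; split => [x /existsNP[k nk]|_ [k _ [x Vx <-]] wx].
    exists k => //; exists (5 ^+ k *: x).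
      by move=> b xb; apply: nk; exists b.
    by rewrite scalerA mulVf ?scale1r ?expf_neq0 ?pnatr_eq0.
  have [b] := wx k; rewrite scalerA mulfV ?scale1r ?expf_neq0 ?pnatr_eq0//.
  exact: Vx.
apply: bigcup_connected => [|k _].
  (* Every scaling fixes 0, so 0 is common to all the pieces. *)
  by exists 0 => k _; exists 0; [exact: open_cross0|rewrite scaler0].
apply: connected_continuous_connected; first exact: open_cross_connected.
exact/continuous_subspaceT/continuous_scale.
Qed.

(** At each level [k] the two scaled crosses are disjoint closed sets covering [web], so the
    component lies in one of them, and [x] decides which. *)
Lemma web_component a x : strand a x -> connected_component web x = strand a.
Proof.
move=> ax; apply/seteqP; split; last first.
  apply: connected_component_max => //; last exact: strand_connected.
  by move=> y ay; apply/webP; exists a.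
move=> y xy k.
pose E b := (fun u : vec3 => 5 ^+ k *: u) @^-1` cross b.
have EI : E true `&` E false = set0.
  by apply/seteqP; split => // u [ut uf]; have := cross_disjoint ut uf.
have : separated (E true) (E false).
  by split; rewrite -(closure_id _).1 //; exact: closed_scaled_cross.
move/connected_subset => /(_ (connected_component web x)) [].
- move=> u /connected_component_sub /(_ k) [[] ub]; by [left|right].
- exact: component_connected.
- move=> sub; have xt := sub _ (connected_component_refl _).
  have -> : a k = true by apply: cross_disjoint (ax k) (xt _); apply/webP; exists a.
  exact: sub xy.
- move=> sub; have xt := sub _ (connected_component_refl _).
  have -> : a k = false by apply: cross_disjoint (ax k) (xt _); apply/webP; exists a.
  exact: sub xy.
Qed.

Lemma strand_centre a : strand a (centre a).
Proof. by case: (cube_strand_centre a). Qed.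

Lemma componentsP C : components web C <-> exists a, C = strand a.
Proof.
split=> [[x /webP[a ax] <-]|[a ->]]; first by exists a; exact: web_component.
exists (centre a); last exact/web_component/strand_centre.
by apply/webP; exists a; exact: strand_centre.
Qed.

(** Cantor's diagonal argument, with sequences coded through their strands. *)
Lemma uncountable_components : ~ countable (components web).
Proof.
move=> /countable_injP[f finj].
have ginj a b : f (strand a) = f (strand b) -> a = b.
  move=> /finj ab; have := strand_centre a; rewrite ab ?inE ?componentsP; last 2 first.
  - by exists a.
  - by exists b.
  by move=> /strand_inj /(_ (strand_centre a)) ->.
(* At most one sequence has code [n], and [diag] is made to differ from it at [n]; at its own code
   [diag] contradicts itself. *)
pose diag n := `[< forall a, f (strand a) = n -> ~~ a n >].
have [|/asboolPn nd] := boolP (diag (f (strand diag))).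
  by move=> dd; have /asboolP/(_ diag erefl) := dd; rewrite dd.
apply: nd => a /ginj ->; apply/negP => dd; have /asboolP/(_ diag erefl) := dd.
by rewrite dd.
Qed.

Lemma strand_unbounded a : ~ [bounded x | x in strand a].
Proof.
move=> /pinfty_ex_gt0[M M0 /= aM].
(* Translation by (m, m, m) puts every coordinate of the centre above [M]. *)
pose m := (Num.floor M + 1).
have /aM : strand a (centre a + int_vec (fun=> m)).
  by rewrite strandDz; exact: strand_centre.
apply/negP; rewrite -ltNge; apply: lt_le_trans (coord_norm_le _ 0).
rewrite !mxE; apply: lt_le_trans (ler_norm _).
by have := floor_itv M; have := expansion_itv a; rewrite -/m; lra.
Qed.

(** * A fractal cube for the chosen digits *)

Definition digits : {set {ffun 'I_3 -> 'I_5}} := [set d | arm true d || arm false d].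

Lemma digitsP d : reflect (exists b, arm b d) (d \in digits).
Proof.
rewrite inE; apply: (iffP orP) => [[]|[[]]]; by [exists true|exists false|left|right].
Qed.

Lemma compact_cube : compact cube.
Proof.
have -> : cube = [set v : vec3 | forall i, `[0 : R, 1]%classic (v ord0 i)].
  by apply/seteqP; split => x Qx i; have := Qx i; rewrite /= in_itv.
exact: (@rV_compact R 3 (fun=> `[0 : R, 1]%classic) (fun=> @segment_compact _ _ _)).
Qed.

Lemma web_fractal : is_fractal_cube digits (web `&` cube).
Proof.
split.
- exists (centre (fun=> true)); have [cw cc] := cube_strand_centre (fun=> true).
  by split => //; apply/webP; eexists; exact: cw.
- by rewrite setIC; apply: compact_closedI; [exact: compact_cube|exact: closed_web].
apply/seteqP; split => [x [/webP[a ax] Qx]|_ [d /digitsP[b bd] [x [/webP[a ax] Qx] <-]]].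
  have [d ad [y [ay Qy] ->]] := cube_strandP (conj ax Qx).
  exists d; first by apply/digitsP; exists (a 0%N).
  by exists y => //; split => //; apply/webP; exists (seq_tail a).
(* A point in the cell of [d] follows the sequence of [x] with [b] prepended. *)
pose a' k := if k is k'.+1 then a k' else b.
have [aw Qw] := @cube_strand_cell a' d x bd (conj ax Qx).
by split => //; apply/webP; exists a'.
Qed.

(** * Uniqueness of the fractal cube, and its lattice hull *)

Section FractalCube.
Variable F : set vec3.
Hypothesis F_fractal : is_fractal_cube digits F.

Lemma fractal_cell x : F x -> exists b d, arm b d /\
  exists2 y, F y & x = 5^-1 *: (y + digit_vec d).
Proof.
have [_ _ FE] := F_fractal.
rewrite {1}FE => -[d /digitsP[b bd] [y Fy <-]].
by exists b, d; split => //; exists y.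
Qed.

Lemma cell_fractal b d y : arm b d -> F y -> F (5^-1 *: (y + digit_vec d)).
Proof.
have [_ _ FE] := F_fractal.
by move=> bd Fy; rewrite FE; exists d; [apply/digitsP; exists b|exists y].
Qed.

(** An extremal argument: the minimum c of a coordinate on [F] is (v + d) / 5 with v >= c and d >=
    0, whence c >= 0; the maximum satisfies c <= (c + 4) / 5, whence c <= 1. *)
Lemma fractal_sub_cube : F `<=` cube.
Proof.
have [F0 cF _] := F_fractal.
move=> x Fx i.
have ci : {within F, continuous (fun u : vec3 => u 0 i)}.
  by apply: continuous_subspaceT => u; exact: coord_continuous.
apply/andP; split.
  have [c /set_mem Fc min_c] := EVT_min_rV F0 cF ci.
  have [b [d [_ [y /mem_set Fy cE]]]] := fractal_cell Fc.
  have := min_c _ Fy; have := min_c x (mem_set Fx).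
  rewrite {1 2}cE !mxE; have : 0 <= ((d i : nat)%:R : R) by [].
  by move: (y 0 i) (x 0 i) => u v; lra.
have [c /set_mem Fc max_c] := EVT_max_rV F0 cF ci.
have [b [d [_ [y /mem_set Fy cE]]]] := fractal_cell Fc.
have := max_c _ Fy; have := max_c x (mem_set Fx).
rewrite {1 2}cE !mxE.
have : ((d i : nat)%:R : R) <= 4 by rewrite (ler_nat _ _ 4) -ltnS.
by move: (y 0 i) (x 0 i) => u v; lra.
Qed.

(** For x = (y + d) / 5, the point 5^(k+1) x differs from 5^k y by an integer vector, so each level
    reduces to the first. *)
Lemma fractal_sub_web : F `<=` web.
Proof.
move=> x Fx k; elim: k x Fx => [|k IH] x /fractal_cell[b [d [bd [y Fy ->]]]].
  by exists b; rewrite expr0 scale1r; apply: cell_cross => //; exact: fractal_sub_cube.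
have [b' yb'] := IH _ Fy; exists b'.
rewrite scalerA exprSr mulfK ?pnatr_eq0// scalerDr digit_vec_int scale_int_vec.
by rewrite crossDz.
Qed.

(** The cell maps preserve [F] and divide distances by 5. As [F] is closed, this gives the reverse
    inclusion in [fractal_unique]. *)
Lemma fractal_approx k a x : cube_strand a x -> exists2 y, F y & `|x - y| <= 5 ^- k.
Proof.
elim: k a x => [|k IH] a x ax.
  have [[y Fy] _ _] := F_fractal; exists y => //.
  rewrite expr0 invr1; apply: cube_norm_sub; last exact: fractal_sub_cube.
  by case: ax.
have [d ad [x' ax' ->]] := cube_strandP ax.
have [y Fy xy] := IH _ _ ax'.
exists (5^-1 *: (y + digit_vec d)); first exact: cell_fractal ad Fy.
rewrite -scalerBr opprD addrACA subrr addr0 normrZ exprS invfM.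
by rewrite ger0_norm // ler_pM2l.
Qed.

Lemma fractal_unique : F = web `&` cube.
Proof.
apply/seteqP; split=> [x Fx|x [/webP[a ax] Qx]].
  by split; [exact: fractal_sub_web|exact: fractal_sub_cube].
apply: closed_approx => [|k]; last exact: fractal_approx (conj ax Qx).
by case: F_fractal => _ cF _; apply: compact_closed cF; exact: norm_hausdorff.
Qed.

Lemma fractal_hull : lattice_hull F = web.
Proof.
rewrite fractal_unique; apply/seteqP; split => [_ [x [z [[wx _] ->]]]|x wx].
  exact/webDz.
have [z Qz] := vec_split x; exists (x - int_vec z), z; rewrite subrK.
by split => //; split => //; rewrite -(webDz _ z) subrK.
Qed.

End FractalCube.

(** * The number of digits *)

Lemma card_digits_ge2 : (2 <= #|digits|)%N.
Proof.
have dig5 b : (dig b < 5)%N by case: b.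
pose c b : {ffun 'I_3 -> 'I_5} := [ffun=> Ordinal (dig5 b)].
have cd b : c b \in digits.
  by apply/digitsP; exists b; apply/armP; exists 0 => j _; rewrite ffunE.
have ct : c true != c false by apply/eqP => /ffunP/(_ 0); rewrite !ffunE.
have c2 : #|[set c true; c false]%SET| = 2%N by rewrite cards2 ct.
apply: leq_trans (eq_leq (esym c2)) _.
apply/subset_leq_card/fintype.subsetP => d; rewrite in_set2 => /orP[] /eqP ->; exact: cd.
Qed.

Lemma card_digits_lt : (#|digits| < 5 ^ 3)%N.
Proof.
have cT : #|[set: {ffun 'I_3 -> 'I_5}]%SET| = (5 ^ 3)%N.
  by rewrite cardsT card_ffun !card_ord.
apply: leq_trans (eq_leq cT).
apply/proper_card/properP; split; first exact: finset.subsetT.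
(* The zero triple has no entry 1 or 3, so it is not a digit. *)
exists [ffun=> ord0] => //; apply/digitsP => -[b /armP[i di]].
have [j /andP[ji _]] := third_coordinate i i.
by have := di j ji; rewrite ffunE; case: b {di}.
Qed.

Theorem theorem2 :
  exists (n : nat) (D : {set {ffun 'I_3 -> 'I_n}}),
    [/\ (2 <= n)%N, (2 <= #|D|)%N, (#|D| < n ^ 3)%N,
        (exists F : set vec3, is_fractal_cube D F) &
        forall F : set vec3, is_fractal_cube D F ->
          let H := lattice_hull F in
          [/\ connected (~` H),
              ~ countable (components H) &
              forall C, components H C ->
                ~ [bounded x | x in C] /\
                forall z : 'I_3 -> int, [set x + int_vec z | x in C] = C]].
Proof.
exists 5%N, digits; split => //.
- exact: card_digits_ge2.
- exact: card_digits_lt.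
- by exists (web `&` cube); exact: web_fractal.
move=> F /fractal_hull ->; split.
- exact: web_compl_connected.
- exact: uncountable_components.
move=> C /componentsP[a ->]; split; first exact: strand_unbounded.
move=> z; apply/seteqP; split => [_ [x ax <-]|x ax]; first exact/strandDz.
by exists (x - int_vec z); rewrite ?subrK// -(strandDz _ _ z) subrK.
Qed.
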